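(* Let $n\ge2$. The sieve projectors $\{\mathbf{e}(1/n,\xi)\}_{\xi=1}^n$ satisfy, for $\xi,\xi_1,\xi_2\in\{1,\dots,n\}$: (1) $\mathbf{e}(1/n,\xi)\otimes\mathbf{e}(1/n,\xi)=\mathbf{e}(1/n,\xi)$. (2) $\mathbf{e}(1/n,\xi_1)\otimes\mathbf{e}(1/n,\xi_2)=\mathbf{0}$ whenever $\xi_1\not\equiv\xi_2\pmod n$. (3) $\sum_{\xi=1}^n\mathbf{e}(1/n,\xi)=\mathbf{1}$. (4) For every $\Psi\in\mathcal{V}$, $$(\Psi\otimes\mathbf{e}(1/n,\xi))[m]=\begin{cases}\Psi[m],&m\equiv\xi\pmod n,\\0,&m\not\equiv\xi\pmod n.\end{cases}$$
   Context: For $f\in\mathbb{Q}/\mathbb{Z}$ and $g\in\mathbb{Q}$, $\mathbf{w}(f,g)[m]=\exp(2\pi i(fm+g))$ for $m\in\mathbb{Z}$, and $\mathcal{V}=\operatorname{span}_{\mathbb{C}}\{\mathbf{w}(f,g)\mid f\in\mathbb{Q}/\mathbb{Z},\,g\in\mathbb{Q}\}$, a ring under pointwise addition and pointwise multiplication $\otimes$, with unit $\mathbf{1}=\mathbf{w}(0,0)$. For $n\ge2$ and $\xi\in\{1,\dots,n\}$ the elementary sieve projector is $$\mathbf{e}(1/n,\xi)[m]=\frac1n\sum_{k=0}^{n-1}e^{-2\pi ik\xi/n}\,\mathbf{w}(k/n,0)[m]=\frac1n\sum_{k=0}^{n-1}\exp\Bigl(\frac{2\pi ik}{n}(m-\xi)\Bigr),\quad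 m\in\mathbb{Z}.$$ *)

(* Defs.v *)
From HB Require Import structures.
From mathcomp Require Import all_boot all_order all_algebra archimedean.
From mathcomp Require Import generic_quotient ring_quotient complex.
From mathcomp Require Import boolp classical_sets functions reals sequences exp trigo.
From mathcomp Require Import ring.

Set Implicit Arguments.
Unset Strict Implicit.
Unset Printing Implicit Defensive.

Import Order.TTheory GRing.Theory Num.Theory.

Local Open Scope ring_scope.
Local Open Scope complex_scope.

Definition QmodZ : zmodType :=
  Quotient.quot (GRing.ZmodClosed.clone rat (@Num.int_num_subdef rat) _).

Definition classQZ (q : rat) : QmodZ := (\pi_QmodZ q)%qT.

Lemma classQZ_eq (q r : rat) :
  (classQZ q == classQZ r) = (q - r \is a Num.int).
Proof. exact/esym/Quotient.idealrBE. Qed.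

Definition cexp (R : realType) (z : R[i]) : R[i] :=
  (expR (complex.Re z))%:C * (cos (complex.Im z) +i* sin (complex.Im z)).

Lemma cexpD (R : realType) (x y : R[i]) : cexp (x + y) = cexp x * cexp y.
Proof.
case: x y => [a b] [c d]; rewrite /cexp /= expRD cosD sinD.
by apply/eqP; rewrite eq_complex /=; apply/andP; split; apply/eqP; ring.
Qed.

Definition twoipi (R : realType) : R[i] := 2 * 'i * (trigo.pi : R)%:C.

Lemma cexp_int (R : realType) (k : int) : cexp (twoipi R * k%:~R) = 1.
Proof.
have e0 : cexp (0 : R[i]) = 1.
  rewrite /cexp /= expR0 cos0 sin0.
  by apply/eqP; rewrite eq_complex /=; apply/andP; split; apply/eqP; ring.
have tE : twoipi R = 0 +i* (trigo.pi *+ 2).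
  by rewrite /twoipi; apply/eqP; rewrite eq_complex /=;
    apply/andP; split; apply/eqP; ring.
have e1 : cexp (twoipi R) = 1.
  rewrite tE /cexp /= expR0 cos2pi sin2pi.
  by apply/eqP; rewrite eq_complex /=; apply/andP; split; apply/eqP; ring.
have en (n : nat) : cexp (twoipi R * n%:R) = 1.
  elim: n => [|n IH]; first by rewrite mulr0.
  by rewrite -natr1 mulrDr mulr1 cexpD IH e1 mulr1.
case: k => n; first exact: en.
have := cexpD (twoipi R * (Negz n)%:~R) (twoipi R * n.+1%:R).
by rewrite -mulrDr NegzE mulrNz pmulrn addNr mulr0 e0 -pmulrn en mulr1.
Qed.

Definition w (R : realType) (f : QmodZ) (g : rat) (m : int) : R[i] :=
  cexp (twoipi R * ratr (repr f * m%:~R + g)).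

(* [w] does not depend on the representative chosen by [repr]. *)
Lemma w_classQZ (R : realType) (q g : rat) (m : int) :
  w R (classQZ q) g m = cexp (twoipi R * ratr (q * m%:~R + g)).
Proof.
rewrite /w; have : classQZ (repr (classQZ q)) == classQZ q.
  by rewrite /classQZ reprK.
rewrite classQZ_eq => /intrP[k /eqP]; rewrite subr_eq => /eqP ->.
have -> : (k%:~R + q) * m%:~R + g = q * m%:~R + g + (k * m)%:~R.
  by rewrite intrM; ring.
by rewrite rmorphD/= mulrDr cexpD ratr_int cexp_int mulr1.
Qed.

Lemma w00 (R : realType) : w R 0 0 = 1.
Proof.
have -> : 0 = classQZ 0 by apply/esym; exact: pi_zeror.
apply/funext => m; rewrite w_classQZ mul0r addr0.
by rewrite rmorph0; exact: (cexp_int R 0).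
Qed.

Lemma wM (R : realType) (f1 f2 g1 g2 : rat) :
  w R (classQZ f1) g1 * w R (classQZ f2) g2 =
  w R (classQZ (f1 + f2)) (g1 + g2).
Proof.
have E f g m : (f * g : int -> R[i]) m = f m * g m by [].
apply/funext => m; rewrite E !w_classQZ -cexpD -mulrDr.
by rewrite -rmorphD; congr (cexp (_ * ratr _)); ring.
Qed.

Definition calV (R : realType) : set (int -> R[i]) :=
  [set Psi | exists s : seq (R[i] * (QmodZ * rat)),
     Psi = \sum_(t <- s) (t.1 \*o w R t.2.1 t.2.2)]%classic.
Arguments calV R _ : clear implicits.

Lemma calV1 (R : realType) : calV R 1.
Proof.
by exists [:: (1, (0, 0))]; rewrite big_seq1 /= w00; apply/funext => m /=;
  rewrite mul1r.
Qed.

Lemma calVB (R : realType) (Psi Phi : int -> R[i]) :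
  calV R Psi -> calV R Phi -> calV R (Psi - Phi).
Proof.
move=> [s ->] [t ->]; exists (s ++ [seq (- x.1, x.2) | x <- t]).
rewrite big_cat big_map /= -sumrN; congr (_ + _).
by apply: eq_bigr => x _; apply/funext => m /=; rewrite mulNr.
Qed.

Lemma calVM (R : realType) (Psi Phi : int -> R[i]) :
  calV R Psi -> calV R Phi -> calV R (Psi * Phi).
Proof.
move=> [s ->] [t ->].
exists [seq (x.1 * y.1, (x.2.1 + y.2.1, x.2.2 + y.2.2)) | x <- s, y <- t].
rewrite big_allpairs_dep mulr_suml; apply: eq_bigr => x _.
rewrite mulr_sumr; apply: eq_bigr => y _ /=.
have E f : f = classQZ (repr f) by rewrite /classQZ reprK.
have -> : x.2.1 + y.2.1 = classQZ (repr x.2.1 + repr y.2.1).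
  by rewrite {1}(E x.2.1) {1}(E y.2.1); apply/esym/pi_addr.
rewrite -wM -!E; apply/funext => m /=.
have M (f g : int -> R[i]) : (f * g) m = f m * g m by [].
by rewrite !M /= mulrACA.
Qed.

(* The projector e(1/n, xi). As 1 <= xi <= n, [xi] is a natural number; the
   functions int -> R[i] carry the library's pointwise ring structure. *)
Definition sieve (R : realType) (n xi : nat) : int -> R[i] :=
  n%:R^-1 \*o \sum_(k < n)
    (cexp (- (twoipi R * k%:R * xi%:R / n%:R))
       \*o w R (classQZ (k%:R / n%:R)) 0).

Lemma sieveE (R : realType) (n xi : nat) (m : int) :
  sieve R n xi m = n%:R^-1 *
    \sum_(k < n) cexp (twoipi R * k%:R / n%:R * (m%:~R - xi%:R)).
Proof.
rewrite /sieve /= fct_sumE; congr (_ * _); apply: eq_bigr => k _ /=.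
have q : ratr (k%:R / n%:R) = k%:R / n%:R :> R[i].
  rewrite rmorphM /= ratr_nat; congr (_ * _).
  by rewrite fmorphV; congr (_^-1); exact: ratr_nat.
rewrite w_classQZ -cexpD addr0 rmorphM /= q ratr_int.
by congr (cexp _); ring.
Qed.

Lemma sieve_calV (R : realType) (n xi : nat) : calV R (sieve R n xi).
Proof.
exists [seq (n%:R^-1 * cexp (- (twoipi R * k%:R * xi%:R / n%:R)),
             (classQZ (k%:R / n%:R), 0)) | k : 'I_n <- index_enum 'I_n].
apply/funext => m; rewrite big_map /sieve /= !fct_sumE mulr_sumr.
by apply: eq_bigr => k _ /=; rewrite mulrA.
Qed.

(* Main.v *)
Require Import Defs.
From mathcomp Require Import all_boot all_order all_algebra.
From mathcomp Require Import boolp classical_sets functions reals complex.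
From mathcomp Require Import trigo exp ring lra.

Import GRing.Theory.
Import Order.TTheory Num.Theory.

Local Open Scope ring_scope.
Local Open Scope complex_scope.

(** Everything follows from one computation: [sieve R n xi] is the indicator
    function of the residue class of [xi] modulo [n] ([sieve_indicator]).  With
    [z] the value of [cexp] at [2 i pi (m - xi) / n], the sum defining
    [sieve R n xi m] is the geometric sum of the powers [z ^+ k], [k < n], and
    [z ^+ n = 1].  Hence the sum is [n] when [z = 1] and vanishes otherwise, and
    [z = 1] exactly when [n] divides [m - xi] ([cexp_root_eq1]).

    Indicators of residue classes are idempotent, those of distinct classes
    have product zero, the classes of [1], ..., [n] partition the integers, and
    multiplying by an indicator restricts a function to the class. *)

Lemma cexp0 (R : realType) : cexp (0 : R[i]) = 1.
Proof. by have := cexp_int R 0; rewrite mulr0. Qed.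

Lemma cexpMn (R : realType) (x : R[i]) (k : nat) :
  cexp (x *+ k) = cexp x ^+ k.
Proof.
by elim: k => [|k IH]; rewrite ?mulr0n ?cexp0 // mulrS exprS cexpD IH.
Qed.

(** Since [cos (2 t) = 1 - 2 (sin t) ^+ 2], a value [1] would force
    [sin (pi * x) = 0], which is impossible for [pi * x] strictly between [0]
    and [pi]. *)
Lemma cexp_twoipi_neq1 (R : realType) (x : R) :
  0 < x < 1 -> cexp (twoipi R * x%:C) != 1.
Proof.
move=> /andP[x0 x1]; apply/eqP => e.
have tE : twoipi R * x%:C = 0 +i* ((pi * x) *+ 2).
  by apply/eqP; rewrite /twoipi eq_complex /=;
    apply/andP; split; apply/eqP; ring.
have s0 : 0 < sin (pi * x).
  apply: sin_gt0_pi; rewrite mulr_gt0 ?pi_gt0//=.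
  by rewrite gtr_pMr ?pi_gt0.
move: e; rewrite tE /cexp /= expR0 => -[+ _].
rewrite mul1r mul0r subr0 cos_mulr2n -mulr_natr => e.
have : sin (pi * x) ^+ 2 = 0 by have := cos2Dsin2 (pi * x); lra.
by move/eqP; rewrite expf_eq0 /= gt_eqF.
Qed.

(** By periodicity [a] may be replaced by its remainder modulo [n], which puts
    the angle in a single period. *)
Lemma cexp_root_eq1 (R : realType) (n : nat) (a : int) : (0 < n)%N ->
  (cexp (twoipi R * (a%:~R / n%:R)) == 1) = (n %| a)%Z.
Proof.
move=> n0; have nC : n%:R != 0 :> R[i] by rewrite pnatr_eq0 -lt0n.
have nZ : n%:Z != 0 by rewrite eqz_nat -lt0n.
have -> : cexp (twoipi R * (a%:~R / n%:R)) =
          cexp (twoipi R * ((a %% n)%Z%:~R / n%:R)).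
  rewrite [in LHS](divz_eq a n) intrD intrM -pmulrn mulrDl mulfK// mulrDr.
  by rewrite cexpD cexp_int mul1r.
rewrite (sameP dvdz_mod0P eqP).
case: (eqVneq (a %% n)%Z 0) => [->|r0].
  by rewrite mul0r mulr0 cexp0 eqxx.
have r_gt0 : 0 < (a %% n)%Z by rewrite lt_def r0 modz_ge0.
have r_ltn : (a %% n)%Z < n by rewrite ltz_pmod.
have nR : 0 < n%:R :> R by rewrite ltr0n.
apply/negbTE.
have -> : (a %% n)%Z%:~R / n%:R = ((a %% n)%Z%:~R / n%:R)%:C :> R[i].
  by rewrite rmorphM /= fmorphV rmorph_int rmorph_nat.
apply: cexp_twoipi_neq1.
by rewrite divr_gt0 ?ltr0z//= ltr_pdivrMr// mul1r pmulrn ltr_int.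
Qed.

(** The geometric sum [s] of the powers of an [n]-th root of unity [z]
    satisfies [(z - 1) * s = z ^+ n - 1 = 0], so it vanishes unless [z = 1]. *)
Lemma sieve_indicator (R : realType) (n xi : nat) (m : int) : (0 < n)%N ->
  sieve R n xi m = if (m == xi %[mod n])%Z then 1 else 0.
Proof.
move=> n0; have nC : n%:R != 0 :> R[i] by rewrite pnatr_eq0 -lt0n.
rewrite sieveE eqz_mod_dvd -(cexp_root_eq1 R _ _ n0).
set z := cexp _.
have -> : \sum_(k < n) cexp (twoipi R * k%:R / n%:R * (m%:~R - xi%:R)) =
          \sum_(k < n) z ^+ k.
  apply: eq_bigr => k _; rewrite /z -cexpMn -mulr_natr; congr (cexp _).
  by rewrite intrB -pmulrn; ring.
case: eqVneq => [->|z1].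
  under eq_bigr do rewrite expr1n.
  by rewrite sumr_const card_ord mulVf.
have zn : z ^+ n = 1.
  by rewrite /z -cexpMn -[X in cexp X]mulr_natr -mulrA divfK// cexp_int.
have := subrX1 z n; rewrite zn subrr => /esym/eqP.
by rewrite mulf_eq0 subr_eq0 (negbTE z1) /= => /eqP ->; rewrite mulr0.
Qed.

(** The summand at [n] equals the one at [0], so the sum may run over
    [0], ..., [n - 1], where only the remainder of [m] contributes. *)
Lemma sum_sieve (R : realType) (n : nat) : (0 < n)%N ->
  \sum_(1 <= xi < n.+1) sieve R n xi = 1.
Proof.
move=> n0; apply/funext => m; rewrite fct_sumE.
have nZ : n%:Z != 0 by rewrite eqz_nat -lt0n.
under eq_bigr do rewrite (sieve_indicator _ _ _ _ n0).
transitivity (\sum_(0 <= xi < n)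
    (if (m == xi %[mod n])%Z then 1 else 0) : R[i]).
  rewrite big_nat_recr//= modzz big_add1 /=.
  by case: n n0 {nZ} => // n _; rewrite [RHS]big_nat_recl// mod0z addrC.
have [r mr] : exists r : nat, (m %% n)%Z = r.
  by exists `|(m %% n)%Z|%N; rewrite gez0_abs// modz_ge0.
have rn : (r < n)%N by rewrite -ltz_nat -mr ltz_pmod.
rewrite big_mkord (bigD1 (Ordinal rn)) //= mr modz_nat modn_small// eqxx.
rewrite big1 ?addr0// => i; rewrite modz_nat modn_small//.
by rewrite -val_eqE eq_sym eqz_nat /= => /negbTE ->.
Qed.

Theorem proposition11p2 (R : realType) (n : nat) (hn : (2 <= n)%N) :
  (* (1) *)
  (forall xi : nat, (1 <= xi <= n)%N ->
     sieve R n xi * sieve R n xi = sieve R n xi)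
  /\
  (* (2) *)
  (forall xi1 xi2 : nat, (1 <= xi1 <= n)%N -> (1 <= xi2 <= n)%N ->
     xi1 <> xi2 %[mod n] ->
     sieve R n xi1 * sieve R n xi2 = 0)
  /\
  (* (3) *)
  \sum_(1 <= xi < n.+1) sieve R n xi = w R 0 0
  /\
  (* (4) *)
  (forall xi : nat, (1 <= xi <= n)%N ->
     forall Psi : int -> R[i], calV R Psi ->
     forall m : int,
       (Psi * sieve R n xi) m =
         if (m == xi %[mod n])%Z then Psi m else 0).
Proof.
have n0 : (0 < n)%N by apply: leq_trans hn.
have fM (f g : int -> R[i]) m : (f * g) m = f m * g m by [].
split=> [xi _|].
  apply/funext => m; rewrite fM !sieve_indicator//.
  by case: ifP => _; rewrite ?mulr1 ?mulr0.
split=> [xi1 xi2 _ _ neq|].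
  apply/funext => m; rewrite fM !sieve_indicator//.
  case: eqP => [e1|_]; last by rewrite mul0r.
  case: eqP => [e2|_]; last by rewrite mulr0.
  by case: neq; apply/eqP; rewrite -eqz_nat -!modz_nat -e1 -e2.
split=> [|xi _ Psi _ m]; first by rewrite sum_sieve// w00.
by rewrite fM sieve_indicator//; case: ifP => _; rewrite ?mulr1 ?mulr0.
Qed.
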